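(* For each integer $n\geq 3$ there are a finite relational structure $\mathbf{A}_n$ and an $n^2$-ary relation $T_n$ over $A_n$ such that: (i) $\mathrm{size}(\mathbf{A}_n,T_n)=O(n^3\log n)$; (ii) $T_n$ is open-definable in $\mathbf{A}_n$; and (iii) every open formula defining $T_n$ in $\mathbf{A}_n$ has at least $(n-1)^n$ literals.
   Context: Vocabularies are finite and purely relational. Open formulas are quantifier-free first-order formulas with equality (Boolean combinations of atomic formulas $v_i=v_j$ and $R(\bar v)$). For a finite relational structure $\mathbf{A}$ and $T\subseteq A^m$, $T$ is open-definable in $\mathbf{A}$ if some open formula $\varphi(x_1,\dots,x_m)$ in the vocabulary of $\mathbf{A}$ satisfies $T=\{\bar a\in A^m:\mathbf{A}\models\varphi[\bar a]\}$; such $\varphi$ is said to define $T$ in $\mathbf{A}$. Sizes: for a vocabulary $\tau$, $\mathrm{size}(\tau)=(|\tau|+\sum_{R\in\tau}\mathrm{ar}(R))\log|\tau|$; for a $\tau$-structure $\mathbf{A}$, $\mathrm{size}(\mathbf{A})=\mathrm{size}(\tau)+(|A|+\sum_{R\in\tau}\mathrm{ar}(R)|R^{\mathbf{A}}|)\log|A|$; for $T\subseteq A^m$, $\mathrm{size}(\mathbf{A},T)=(\mathrm{size}(\mathbf{A})+m|T|)\log|A|$, where $\log x$ is read as $\max\{\log x,1\}$. *)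

(* Defs.v *)
From HB Require Import structures.
From mathcomp Require Import all_boot all_order all_algebra.
From mathcomp Require Import all_classical all_reals all_analysis.
Set Implicit Arguments.
Unset Strict Implicit.
Unset Printing Implicit Defensive.
Import Order.TTheory GRing.Theory Num.Theory.
Import numFieldNormedType.Exports.
Local Open Scope ring_scope.

Record vocabulary := Vocabulary {
  symbol :> finType;
  arity : symbol -> nat
}.
Arguments arity {v}.

Record structure (tau : vocabulary) := Structure {
  universe :> finType;
  interp : forall r : tau, {set (arity r).-tuple universe};
  universe_gt0 : (0 < #|universe|)%N
}.
Arguments interp {tau} s r.

(* Open formulas in the variables x_0, ..., x_(m-1). *)
Inductive open_formula (tau : vocabulary) (m : nat) : Type :=
| FEq of 'I_m & 'I_m
| FRel (r : tau) of (arity r).-tuple 'I_m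
| FNot of open_formula tau m
| FAnd of open_formula tau m & open_formula tau m
| FOr of open_formula tau m & open_formula tau m.

Fixpoint sat (tau : vocabulary) (A : structure tau) (m : nat)
    (a : m.-tuple A) (phi : open_formula tau m) : bool :=
  match phi with
  | FEq i j => tnth a i == tnth a j
  | FRel r v => map_tuple (tnth a) v \in interp A r
  | FNot p => ~~ sat a p
  | FAnd p q => sat a p && sat a q
  | FOr p q => sat a p || sat a q
  end.

(* Literals are counted with multiplicity: an occurrence of an atomic formula,
   signed by the parity of the negations above it, is one literal of the
   formula. *)
Fixpoint num_literals (tau : vocabulary) (m : nat)
    (phi : open_formula tau m) : nat :=
  match phi with
  | FEq _ _ => 1
  | FRel _ _ => 1
  | FNot p => num_literals p
  | FAnd p q => num_literals p + num_literals q
  | FOr p q => num_literals p + num_literals q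
  end.

Definition defines (tau : vocabulary) (A : structure tau) (m : nat)
    (phi : open_formula tau m) (T : {set m.-tuple A}) : Prop :=
  T = [set a | sat a phi].

Definition open_definable (tau : vocabulary) (A : structure tau) (m : nat)
    (T : {set m.-tuple A}) : Prop :=
  exists phi : open_formula tau m, defines phi T.

Section Size.
Variable R : realType.

(* max{log_2 x, 1} *)
Definition log1 (x : nat) : R := Num.max (ln (x%:R : R) / ln 2) 1.

Definition size_voc (tau : vocabulary) : R :=
  (#|tau| + \sum_(r : tau) arity r)%N%:R * log1 #|tau|.

Definition size_struct (tau : vocabulary) (A : structure tau) : R :=
  size_voc tau +
  (#|A| + \sum_(r : tau) arity r * #|interp A r|)%N%:R * log1 #|A|.

Definition size_rel (tau : vocabulary) (A : structure tau) (m : nat)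
    (T : {set m.-tuple A}) : R :=
  (size_struct A + (m * #|T|)%N%:R) * log1 #|A|.

End Size.

(* Main.v *)
Require Import Defs.
From HB Require Import structures.
From mathcomp Require Import all_boot all_order all_algebra.
From mathcomp Require Import all_classical all_reals all_analysis.
From mathcomp Require Import zify lra.
Set Implicit Arguments.
Unset Strict Implicit.
Unset Printing Implicit Defensive.
Import Order.TTheory GRing.Theory Num.Theory.
Import numFieldNormedType.Exports.
Local Open Scope classical_set_scope.
Local Open Scope ring_scope.

(* With m = n^2, split all but one or two of the m variables into k pairs
   pos (i, false), pos (i, true), keeping a hub h and a last variable l (which
   may be the hub). The target consists of a single injective tuple, [safe].
   For every J : {0,..,k-1} -> bool the tuple [bad J] is a disjoint copy of
   [safe] in which the variable pos (i, J i) of each pair takes the value [inr i].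
   Relations K_i on h, pos (i, false), pos (i, true), and L on h, l, contain just
   the images of [safe] and of the bad tuples: they force a tuple satisfying the
   same atoms to be [safe] or some [bad J]. A k-ary relation R holds only at
   (inr 0, .., inr (k-1)), so [bad J] differs from [safe] in exactly one
   atom, R at the pos (i, J i), and a formula defining the target must contain
   all these 2^k >= (n-1)^n atoms. Since a pair admits only two choices, the
   whole structure has size O(n^2 log(n)^2), within the required bound. *)

(** * Counting literals by tuples that differ in a single atom *)

Section LiteralLowerBound.
Variables (tau : vocabulary) (m : nat).

Definition rel_atom := {r : tau & (arity r).-tuple 'I_m}.

Definition holds (A : structure tau) (a : m.-tuple A) (u : rel_atom) : bool :=
  map_tuple (tnth a) (tagged u) \in interp A (tag u).

Fixpoint rel_atoms (phi : open_formula tau m) : seq rel_atom :=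
  match phi with
  | FEq _ _ => [::]
  | FRel r v => [:: Tagged (fun r : tau => (arity r).-tuple 'I_m) v]
  | FNot p => rel_atoms p
  | FAnd p q => rel_atoms p ++ rel_atoms q
  | FOr p q => rel_atoms p ++ rel_atoms q
  end.

Lemma size_rel_atoms phi : (size (rel_atoms phi) <= num_literals phi)%N.
Proof. by elim: phi => //= p IHp q IHq; rewrite size_cat leq_add. Qed.

Lemma sat_eq_atoms (A : structure tau) (a b : m.-tuple A) phi :
    (forall i j, (tnth a i == tnth a j) = (tnth b i == tnth b j)) ->
    {in rel_atoms phi, holds a =1 holds b} ->
  sat a phi = sat b phi.
Proof.
move=> eq_ab; elim: phi => //=.
- by move=> r v /(_ (Tagged _ v)); rewrite inE eqxx => /(_ isT).
- by move=> p IHp /IHp ->.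
- move=> p IHp q IHq ab; rewrite IHp 1?IHq // => u up; apply: ab;
  by rewrite mem_cat up ?orbT.
- move=> p IHp q IHq ab; rewrite IHp 1?IHq // => u up; apply: ab;
  by rewrite mem_cat up ?orbT.
Qed.

(** If the atom [u x] did not occur in [phi], then [a] and [b x] would agree on every atom of [phi],
    which could not separate them. So [phi] contains all the atoms [u x], pairwise distinct since
    [u] is injective. *)
Lemma num_literals_ge (A : structure tau) (I : finType) (a : m.-tuple A)
    (b : I -> m.-tuple A) (u : I -> rel_atom) (phi : open_formula tau m) :
    injective u ->
    (forall x i j, (tnth a i == tnth a j) = (tnth (b x) i == tnth (b x) j)) ->
    (forall x v, v != u x -> holds a v = holds (b x) v) ->
    (forall x, sat a phi != sat (b x) phi) ->
  (#|I| <= num_literals phi)%N.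
Proof.
move=> inj_u eq_ab hold_ab sat_ab.
apply: leq_trans (size_rel_atoms phi); rewrite cardE -(size_map u).
apply: uniq_leq_size; first by rewrite map_inj_uniq ?enum_uniq.
move=> _ /mapP[x _ ->]; apply: contraT => ux; case/eqP: (sat_ab x).
apply: sat_eq_atoms => [i j|v vphi]; first exact: eq_ab.
by apply: hold_ab; apply: contraNneq ux => <-.
Qed.

End LiteralLowerBound.

Lemma tnth_comp (T : Type) (m n : nat) (x : m.-tuple T) (v : n.-tuple 'I_m) q :
  tnth (map_tuple (tnth x) v) q = tnth x (tnth v q).
Proof. exact: tnth_map. Qed.

(** * The structure, and the atoms that hold at [safe] and at the bad tuples *)

Section Gadget.
Variables (k m : nat) (pos : 'I_k * bool -> 'I_m) (h l : 'I_m).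
Hypothesis k_gt0 : (0 < k)%N.
Hypothesis pos_inj : injective pos.
Hypothesis pos_h : forall x, pos x != h.
Hypothesis pos_l : forall x, pos x != l.
Hypothesis cover : forall p, [\/ p = h, p = l | exists x, p = pos x].

Definition symb := ('I_k + bool)%type.
Notation K i := (inl i : symb).
Notation L := (inr false : symb).
Notation Rk := (inr true : symb).

Definition ar (r : symb) : nat :=
  match r with inl _ => 3 | inr false => 2 | inr true => k end.

Definition voc : vocabulary := @Vocabulary symb ar.

(** Two copies of the set of variables, flagged [false] for [safe] and [true] for the bad tuples,
    together with the k marks on which [R] holds. *)
Definition elt := ((bool * 'I_m) + 'I_k)%type.

Definition safe : m.-tuple elt := [tuple inl (false, p) | p < m].

Definition bad (J : {ffun 'I_k -> bool}) : m.-tuple elt :=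
  [tuple if [pick i | pos (i, J i) == p] is Some i then inr i
         else inl (true, p) | p < m].

(** For each symbol, the one tuple of variables at which it will hold under [bad J]; only the tuple
    for [R] varies with [J]. *)
Definition scheme (J : {ffun 'I_k -> bool}) (r : symb) : (ar r).-tuple 'I_m :=
  match r with
  | inl i => [tuple h; pos (i, false); pos (i, true)]
  | inr false => [tuple h; l]
  | inr true => [tuple pos (i, J i) | i < k]
  end.

Lemma scheme_R J (i : 'I_k) : tnth (scheme J Rk) i = pos (i, J i).
Proof. by rewrite tnth_mktuple. Qed.

Definition cst (s : bool) : {ffun 'I_k -> bool} := [ffun=> s].

(* A symbol [K i] sees a bad tuple only through [J i] and [R] does not see [J]
   at all, so constant [J]s account for all the tuples [bad J]. *)
Definition rel (r : symb) : {set (ar r).-tuple elt} :=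
  [set map_tuple (tnth (bad (cst s))) (scheme (cst s) r) | s : bool] :|:
  (if r == Rk then finset.set0
   else [set map_tuple (tnth safe) (scheme (cst true) r)]%SET).

Fact elt_gt0 : (0 < #|{: elt}|)%N.
Proof. by apply/card_gt0P; exists (inl (true, h)). Qed.

Definition gadget : structure voc := @Structure voc elt rel elt_gt0.

Lemma safeE p : tnth safe p = inl (false, p).
Proof. by rewrite tnth_mktuple. Qed.

Lemma bad_pos J i s :
  tnth (bad J) (pos (i, s)) = if s == J i then inr i else inl (true, pos (i, s)).
Proof.
rewrite tnth_mktuple; case: pickP => [j /eqP/pos_inj[-> ->]|nj]; first by rewrite eqxx.
by case: eqP => // sJ; have := nj i; rewrite -sJ eqxx.
Qed.

Lemma bad_out J p : (forall x, pos x != p) -> tnth (bad J) p = inl (true, p).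
Proof.
by move=> np; rewrite tnth_mktuple; case: pickP => // i; rewrite (negPf (np _)).
Qed.

Lemma bad_inr J p i : tnth (bad J) p = inr i -> p = pos (i, J i).
Proof. by rewrite tnth_mktuple; case: pickP => // j /eqP<- [->]. Qed.

Lemma bad_inl J p x : tnth (bad J) p = inl x ->
  x = (true, p) /\ forall i, pos (i, J i) != p.
Proof.
by rewrite tnth_mktuple; case: pickP => // np [<-]; split=> // i; rewrite np.
Qed.

Lemma safe_inj : injective (tnth safe).
Proof. by move=> p q; rewrite !safeE => -[]. Qed.

Lemma bad_inj J : injective (tnth (bad J)).
Proof.
move=> p q pq; case E: (tnth (bad J) p) => [x|i].
  by have [Ep _] := bad_inl E; move: E; rewrite pq => /bad_inl[]; rewrite Ep => -[].
by rewrite (bad_inr E); move: E; rewrite pq => /bad_inr ->.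
Qed.

Lemma safe_neq_bad J p q : tnth safe p <> tnth (bad J) q.
Proof. by rewrite safeE => /esym/bad_inl[]. Qed.

Lemma ar_gt0 r : (0 < ar r)%N.
Proof. by case: r => // -[]. Qed.

(** [safe] and the bad tuples share no value, so comparing first coordinates excludes the bad
    images; on the safe image, injectivity of [safe] recovers [v]. *)
Lemma holds_safe r (v : (ar r).-tuple 'I_m) :
  (map_tuple (tnth safe) v \in rel r) = (r != Rk) && (v == scheme (cst true) r).
Proof.
rewrite finset.in_setU; case: imsetP => [[s _] /(congr1 (fun t => tnth t (Ordinal (ar_gt0 r))))|_] /=.
  by rewrite !tnth_comp => E; case: (safe_neq_bad E).
case: ifP => _; first by rewrite finset.in_set0.
rewrite finset.in_set1; apply/eqP/eqP => [E|->//].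
apply: eq_from_tnth => q; apply: safe_inj.
by have := congr1 (fun t => tnth t q) E; rewrite !tnth_comp.
Qed.

Lemma bad_scheme J r : map_tuple (tnth (bad J)) (scheme J r) \in rel r.
Proof.
rewrite finset.in_setU; apply/orP; left; apply/imsetP.
(* Only [K i] distinguishes the two constants; for [L] and [R] both yield the same image. *)
exists (if r is inl i then J i else true) => //; apply: eq_from_tnth => q.
case: r q => [i|[]] q; rewrite !tnth_comp.
- case: q => -[|[|[|//]]] ?; rewrite !(tnth_nth h) /=.
  + by rewrite !bad_out.
  + by rewrite !bad_pos ffunE.
  + by rewrite !bad_pos ffunE.
- by rewrite !scheme_R !bad_pos !eqxx.
- by case: q => -[|[|//]] ?; rewrite !(tnth_nth h) /= !bad_out.
Qed.

Lemma holds_bad J r (v : (ar r).-tuple 'I_m) :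
  (map_tuple (tnth (bad J)) v \in rel r) = (v == scheme J r).
Proof.
apply/idP/eqP => [|->]; last exact: bad_scheme.
rewrite finset.in_setU => /orP[|]; last first.
  case: ifP => _; first by rewrite finset.in_set0.
  rewrite finset.in_set1 => /eqP/(congr1 (fun t => tnth t (Ordinal (ar_gt0 r)))).
  by rewrite !tnth_comp => E; case: (safe_neq_bad (esym E)).
case/imsetP => s _ E.
have {}E q : tnth (bad J) (tnth v q) = tnth (bad (cst s)) (tnth (scheme (cst s) r) q).
  by have := congr1 (fun t => tnth t q) E; rewrite !tnth_comp.
apply: eq_from_tnth => q; apply: (@bad_inj J); rewrite E.
case: r v E q => [i|[]] v E q.
(* If [s] differed from [J i], the position [pos (i, J i)], at index 1 or 2 of the scheme, would be
   unmarked in [bad (cst s)] and so keep its own flagged value. But [bad J] never takes that value,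
   since it marks this position. *)
- have sJ : s = J i.
    apply/eqP; apply: contraT => sJ.
    have := E (if s then 1 else 2%:R : 'I_3).
    have -> : tnth (scheme (cst s) (K i)) (if s then 1 else 2%:R : 'I_3) = pos (i, J i).
      by case: s {E} sJ; case: (J i).
    rewrite bad_pos ffunE eq_sym (negPf sJ) => Ei.
    by have [[<-] /(_ i)/eqP] := bad_inl Ei.
  case: q => -[|[|[|//]]] ?; rewrite !(tnth_nth h) /=.
  + by rewrite !bad_out.
  + by rewrite !bad_pos ffunE sJ.
  + by rewrite !bad_pos ffunE sJ.
- by rewrite !scheme_R !bad_pos !eqxx.
- by case: q => -[|[|//]] ?; rewrite !(tnth_nth h) /= !bad_out.
Qed.

(** * Definability of the target *)

Definition target : {set m.-tuple gadget} := [set safe : m.-tuple gadget]%SET.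

Local Notation form := (open_formula voc m).
Local Notation conj := (@FAnd voc m).

(** The formula [h = h] is always true and serves as the neutral element of conjunction. *)
Lemma sat_big (A : structure voc) (x : m.-tuple A) (I : finType) (F : I -> form) :
  sat x (\big[conj/@FEq voc m h h]_(i : I) F i) = [forall i, sat x (F i)].
Proof.
rewrite (big_morph (sat x) (id1 := true) (op1 := andb)) ?big_andE //=.
exact: eqxx.
Qed.

Definition target_formula : form :=
  conj (\big[conj/@FEq voc m h h]_(i : 'I_k)
          @FRel voc m (K i) (scheme (cst true) (K i)))
    (conj (@FRel voc m L (scheme (cst true) L))
       (\big[conj/@FEq voc m h h]_(J : {ffun 'I_k -> bool})
          FNot (@FRel voc m Rk (scheme J Rk)))).

Lemma sat_target_formula (x : m.-tuple gadget) :
  sat x target_formula =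
  [&& [forall i, sat x (@FRel voc m (K i) (scheme (cst true) (K i)))],
      sat x (@FRel voc m L (scheme (cst true) L)) &
      [forall J, ~~ sat x (@FRel voc m Rk (scheme J Rk))]].
Proof. by rewrite /target_formula /= !sat_big. Qed.

Lemma sat_safe r (v : (ar r).-tuple 'I_m) :
  sat (safe : m.-tuple gadget) (@FRel voc m r v) =
    (r != Rk) && (v == scheme (cst true) r).
Proof. exact: holds_safe. Qed.

Lemma target_definable : open_definable target.
Proof.
exists target_formula; apply/finset.setP => x; rewrite finset.in_set1 finset.inE.
rewrite sat_target_formula; apply/eqP/and3P => [->|[/forallP Kx Lx /forallP Rx]].
  split; last by apply/forallP => J; rewrite sat_safe.
    by apply/forallP => i; rewrite sat_safe eqxx.
  by rewrite sat_safe eqxx.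
(* Each [K i] atom fixes the hub and the i-th pair, up to the alternative safe or bad and, in the
   bad case, the choice [s], which may vary with [i]. *)
have {}Kx i : (exists s : bool, [/\ tnth x h = inl (true, h) &
      forall b, tnth x (pos (i, b)) = tnth (bad (cst s)) (pos (i, b))]) \/
    (tnth x h = inl (false, h) /\ forall b, tnth x (pos (i, b)) = tnth safe (pos (i, b))).
  have : map_tuple (tnth x) (scheme (cst true) (K i)) \in rel (K i) := Kx i.
  rewrite finset.in_setU => /orP[/imsetP[s _] E|].
    left; exists s; have {}E q := congr1 (fun t => tnth t q) E.
    split; first by have := E 0; rewrite !tnth_comp /= !(tnth_nth h) /= bad_out.
    case; first by have := E 2%:R; rewrite !tnth_comp.
    by have := E 1; rewrite !tnth_comp.
  rewrite finset.in_set1 => /eqP E; right; have {}E q := congr1 (fun t => tnth t q) E.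
  split; first by have := E 0; rewrite !tnth_comp /= !(tnth_nth h) /= safeE.
  case; first by have := E 2%:R; rewrite !tnth_comp.
  by have := E 1; rewrite !tnth_comp.
have {}Lx : exists s, tnth x h = inl (s, h) /\ tnth x l = inl (s, l).
  have : map_tuple (tnth x) (scheme (cst true) L) \in rel L := Lx.
  rewrite finset.in_setU => /orP[/imsetP[s _]|] E.
    exists true; have {}E q := congr1 (fun t => tnth t q) E.
    by have := E 0; have := E 1; rewrite !tnth_comp /= !(tnth_nth h) /= !bad_out.
  exists false; have {}E q := congr1 (fun t => tnth t q) (finset.set1P E).
  by have := E 0; have := E 1; rewrite !tnth_comp /= !(tnth_nth h) /= !safeE.
(* The hub is common to all the atoms, so its flag decides globally: [false] makes [x] equal to
   [safe], [true] makes it a bad tuple. *)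
have [[] [xh xl]] := Lx; last first.
  apply: eq_from_tnth => p; have [->|->|[[i b] ->]] := cover p; rewrite ?safeE //.
  by have [[s []]|[_ ->]] := Kx i; rewrite ?xh ?safeE.
(* The choice function is read off from the marks; the negated [R] atom for this [J] then fails at
   [x]. *)
pose J : {ffun 'I_k -> bool} := [ffun i => tnth x (pos (i, true)) == inr i].
suff xE : x = bad J by case/negP: (Rx J); rewrite xE; exact: bad_scheme.
apply: eq_from_tnth => p; have [->|->|[[i b] ->]] := cover p.
- by rewrite bad_out.
- by rewrite bad_out.
have [[s [_ E]]|[]] := Kx i; last by rewrite xh.
rewrite E !bad_pos !ffunE E bad_pos ffunE.
by case: s {E}; rewrite ?eqxx.
Qed.

(** * The exponential lower bound for the target *)

Lemma target_num_literals (phi : form) :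
  defines phi target -> (2 ^ k <= num_literals phi)%N.
Proof.
move=> defT.
have sat_phi (x : m.-tuple gadget) : sat x phi = (x == safe).
  have := congr1 (fun S : {set m.-tuple gadget} => x \in S) defT.
  by rewrite finset.in_set1 finset.inE.
rewrite -[X in (X ^ _)%N]card_bool -[X in (_ ^ X)%N](card_ord k) -card_ffun.
pose u J : rel_atom voc m := Tagged (fun r : voc => (arity r).-tuple 'I_m) (scheme J Rk : (@arity voc Rk).-tuple 'I_m).
apply: (@num_literals_ge voc m gadget _ safe bad u).
- move=> J J' /eqP; rewrite eq_Tagged => /eqP E; apply/ffunP => i.
  have := congr1 (fun t => tnth t i) E; rewrite !tnth_mktuple.
  by case/pos_inj.
- by move=> J i j; rewrite (inj_eq safe_inj) (inj_eq (@bad_inj J)).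
(* The schemes of [K i] and [L] do not depend on [J], so these atoms agree at [safe] and [bad J]; an
   [R] atom other than [u J] fails at both. *)
- move=> J [r v] vu; rewrite /holds /= holds_safe holds_bad.
  case: r v vu => [i|[]] v vu //=; apply/esym/negbTE/eqP => vS.
  by case/eqP: vu; rewrite vS.
- move=> J; rewrite !sat_phi eqxx.
  by apply/eqP => /esym/eqP E; apply: (@safe_neq_bad J h h); rewrite E.
Qed.

(** * Size estimates *)

Lemma card_elt : #|{: elt}| = (2 * m + k)%N.
Proof. by rewrite card_sum card_prod card_bool !card_ord. Qed.

Lemma card_symb : #|{: symb}| = (k + 2)%N.
Proof. by rewrite card_sum card_bool card_ord. Qed.

Lemma sum_symb (F : symb -> nat) :
  \sum_r F r = (\sum_(i < k) F (K i) + (F L + F Rk))%N.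
Proof. by rewrite big_sumType /= big_bool /= [X in (_ + X)%N]addnC. Qed.

Lemma card_rel r : (#|rel r| <= 3 - (r == Rk))%N.
Proof.
have le2 : (#|[set map_tuple (tnth (bad (cst s))) (scheme (cst s) r) | s : bool]%SET| <= 2)%N.
  by apply: leq_trans (leq_imset_card _ _) _; rewrite card_bool.
apply: leq_trans (leq_card_setU _ _) _.
by case: (r == Rk); rewrite ?cards0 ?cards1 ?addn0 // addn1.
Qed.

Lemma sum_ar : (\sum_(r : voc) arity r = 4 * k + 2)%N.
Proof. by rewrite sum_symb /= sum_nat_const card_ord; lia. Qed.

Lemma sum_rel : (\sum_(r : voc) arity r * #|interp gadget r| <= 11 * k + 6)%N.
Proof.
apply: (@leq_trans (\sum_(r : symb) ar r * (3 - (r == Rk)))%N).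
  by apply: leq_sum => r _; rewrite leq_mul2l card_rel orbT.
by rewrite sum_symb /= sum_nat_const card_ord; lia.
Qed.

Lemma log1_ge1 (R : realType) n : 1 <= log1 R n.
Proof. by rewrite /log1 le_max lexx orbT. Qed.

Lemma ln2_gt0 (R : realType) : 0 < ln 2 :> R.
Proof. by rewrite ln_gt0 // ltr1n. Qed.

Lemma ler_log1 (R : realType) (p q : nat) :
  (0 < p)%N -> (p <= q)%N -> log1 R p <= log1 R q.
Proof.
move=> p0 pq; rewrite /log1 ge_max !le_max lexx orbT andbT ler_pM2r ?invr_gt0 ?ln2_gt0 //.
by rewrite ler_ln ?posrE ?ltr0n ?ler_nat ?pq // (leq_trans p0).
Qed.

Lemma log1_cube (R : realType) n : (0 < n)%N -> log1 R (n ^ 3) <= 3 * log1 R n.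
Proof.
move=> n0; rewrite {1}/log1 natrX lnXn ?ltr0n // ge_max; apply/andP; split.
  by rewrite -[ln _ *+ 3]mulr_natl -mulrA ler_pM2l // /log1 le_max lexx.
by have := log1_ge1 R n; lra.
Qed.

Lemma log1_le (R : realType) n : (0 < n)%N -> log1 R n <= n%:R.
Proof.
move=> n0; rewrite /log1 ge_max ler1n n0 andbT ler_pdivrMr ?ln2_gt0 //.
rewrite mulr_natl -lnXn // ler_ln ?posrE ?ltr0n ?exprn_gt0 //.
by rewrite -natrX ler_nat ltnW // ltn_expl.
Qed.

Lemma size_target (R : realType) : (k.*2 <= m)%N ->
  size_rel R target <= 22 * m%:R * log1 R (3 * m) ^+ 2.
Proof.
move=> km; have m0 : (0 < m)%N by lia.
have X1 := log1_ge1 R (3 * m); set X := log1 R (3 * m) in X1 *.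
have lA : log1 R #|gadget| <= X by apply: ler_log1; rewrite ?universe_gt0 // card_elt; lia.
have lV : log1 R #|voc| <= X by apply: ler_log1; rewrite card_symb; lia.
have m1 : (1 : R) <= m%:R by rewrite ler1n.
have := sum_rel; rewrite /size_rel /size_struct /size_voc sum_ar.
move: lA lV (log1_ge1 R #|gadget|) (log1_ge1 R #|voc|).
rewrite [#|target|]cards1 muln1 card_elt card_symb.
set a := log1 R _; set b := log1 R _; set s := (\sum_(r : _) _)%N => lA lV a1 b1 ls.
have cV : (k + 2 + (4 * k + 2))%N%:R <= 7 * m%:R :> R by rewrite -natrM ler_nat; lia.
have cA : (2 * m + k + s)%N%:R <= 14 * m%:R :> R by rewrite -natrM ler_nat; lia.
set p := _%:R in cV *; set q := _%:R in cA *.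
have p0 : 0 <= p :> R by exact: ler0n.
have q0 : 0 <= q :> R by exact: ler0n.
have h1 : p * b <= 7 * m%:R * X by apply: ler_pM => //; lra.
have h2 : q * a <= 14 * m%:R * X by apply: ler_pM => //; lra.
have h3 : m%:R <= m%:R * X by rewrite ler_peMr //; lra.
(* The constant is 22 = 7 + 14 + 1: vocabulary, structure, and the single tuple of the target. The
   second factor [X] is the outer logarithm in [size_rel]. *)
rewrite (_ : 22 * m%:R * X ^+ 2 = (22 * m%:R * X) * X); last by rewrite expr2 mulrA.
apply: ler_pM => //; [|lra|lra].
by rewrite !addr_ge0 // mulr_ge0 //; lra.
Qed.

End Gadget.

(** * Layout of the variables and comparison of exponentials *)

Lemma ex_layout m : (0 < m)%N ->
  exists (pos : 'I_(m.-1./2) * bool -> 'I_m) (h l : 'I_m),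
    [/\ injective pos, forall x, pos x != h, forall x, pos x != l &
        forall p, [\/ p = h, p = l | exists x, p = pos x]].
Proof.
case: m => // m _ /=.
have bd (i : 'I_m./2) (s : bool) : (i.*2 + s < m./2.*2)%N.
  by have := ltn_ord i; case: s; lia.
have mE : (m./2.*2 <= m)%N by lia.
(* Pair [i] occupies positions 2i and 2i+1. The hub comes right after the pairs and [l] is the last
   position; they coincide when the number of variables is odd. *)
pose pos (x : 'I_m./2 * bool) : 'I_m.+1 := inord (x.1.*2 + x.2).
have posE i s : pos (i, s) = (i.*2 + s)%N :> nat.
  by rewrite inordK //=; have := bd i s; lia.
exists pos, (inord m./2.*2), ord_max; split.
- move=> [i s] [j t] /(congr1 val); rewrite /= !posE => E.
  have ij : i = j by apply/val_inj => /=; move: E; case: s t => -[]; lia.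
  by congr pair => //; move: E; rewrite ij => /addnI; case: s t => -[].
- move=> [i s]; rewrite -val_eqE /= posE inordK; last by lia.
  by have := bd i s; lia.
- move=> [i s]; rewrite -val_eqE /= posE.
  by have := bd i s; lia.
- move=> p; case: (ltnP p m./2.*2) => pm.
    have p2 : (p./2 < m./2)%N by lia.
    constructor 3; exists (Ordinal p2, odd p); apply/val_inj; rewrite /= posE /=.
    by rewrite addnC odd_double_half.
  case: (eqVneq (p : nat) m./2.*2) => pE.
    by constructor 1; apply/val_inj; rewrite /= inordK ?pE //; lia.
  by constructor 2; apply/val_inj => /=; have := ltn_ord p; lia.
Qed.

Lemma sqr_le_exp2 n : (5 <= n)%N -> ((n - 1) ^ 2 <= 2 ^ (n - 1))%N.
Proof.
case: n => // n; rewrite subn1 /= ltnS; elim: n => // n IHn.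
rewrite leq_eqVlt => /predU1P[<-//|n4]; have := IHn n4.
by rewrite (expnS 2 n) -!mulnn; nia.
Qed.

Lemma exp_le_exp2 n : (3 <= n)%N -> ((n - 1) ^ n <= 2 ^ ((n ^ 2).-1./2))%N.
Proof.
(* The cases 3 and 4 are computed: 8 <= 16 and 81 <= 128. From 5 on both sides are squared, so that
   [sqr_le_exp2] applies to the base and the halved exponent is doubled. *)
case: n => [|[|[|[|[|n]]]]] // _; set N := n.+4.+1.
rewrite -(@leq_exp2r _ _ 2) // -expnM mulnC expnM.
apply: (@leq_trans ((2 ^ (N - 1)) ^ N)%N); first by rewrite leq_exp2r // sqr_le_exp2.
rewrite -!expnM leq_exp2l // -mulnn; set u := (N * N)%N.
have : (u = (N - 1) * N + N)%N by rewrite /u mulnBl mul1n subnK // leq_pmulr.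
by have : (5 <= N)%N; lia.
Qed.

(** * The hard relation for each n, and the asymptotic statement *)

Lemma ex_hard_relation (R : realType) n : (3 <= n)%N ->
  exists (tau : vocabulary) (A : structure tau) (T : {set (n ^ 2)%N.-tuple A}),
    [/\ size_rel R T <= 198 * (n%:R ^+ 3 * log1 R n), open_definable T &
        forall phi : open_formula tau (n ^ 2),
          defines phi T -> ((n - 1) ^ n <= num_literals phi)%N].
Proof.
move=> n3; have n9 : (9 <= n ^ 2)%N by rewrite (@leq_exp2r 3 n 2).
have [|pos [h [l [pos_inj pos_h pos_l cover]]]] := @ex_layout (n ^ 2); first by lia.
have k0 : (0 < (n ^ 2).-1./2)%N by lia.
exists (voc _), (gadget pos h l), (target pos h l); split.
- have n0 : (0 < n)%N by lia.
  apply: le_trans (size_target pos h l k0 R _) _; first by lia.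
  have lX : log1 R (3 * n ^ 2) <= 3 * log1 R n.
    apply: le_trans (log1_cube R n0); apply: ler_log1; first by lia.
    by rewrite [X in (_ <= X)%N]expnS leq_mul2r n3 orbT.
  have := log1_le R n0; have := log1_ge1 R (3 * n ^ 2); have := log1_ge1 R n.
  move: lX; rewrite natrX; set X := log1 R _; set Y := log1 R n; set z := n%:R.
  (* One of the two logarithms is traded for a factor n; with 22 from [size_target] this gives 198 =
     22 * 9. *)
  move=> XY Y1 X1 Yz; have : X ^+ 2 <= 9 * (z * Y) by nra.
  have z2 : 0 <= z ^+ 2 by exact: sqr_ge0.
  by move=> /(ler_wpM2l z2); rewrite (exprS z 2); nra.
- exact: target_definable.
- move=> phi /target_num_literals-/(_ k0 pos_inj pos_h pos_l).
  exact: leq_trans (exp_le_exp2 n3).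
Qed.

Theorem theorem5p1 (R : realType) :
  exists (tau : nat -> vocabulary) (A : forall n : nat, structure (tau n))
         (T : forall n : nat, {set (n ^ 2)%N.-tuple (A n)}),
    ((fun n : nat => size_rel R (T n) : R^o)
       =O_\oo (fun n : nat => n%:R ^+ 3 * log1 R n : R^o)) /\
    (forall n : nat, (3 <= n)%N ->
       open_definable (T n) /\
       (forall phi : open_formula (tau n) (n ^ 2),
          defines phi (T n) -> ((n - 1) ^ n <= num_literals phi)%N)).
Proof.
have H n : exists t : {tau : vocabulary & {A : structure tau & {set (n ^ 2)%N.-tuple A}}},
    (3 <= n)%N ->
    [/\ size_rel R (projT2 (projT2 t)) <= 198 * (n%:R ^+ 3 * log1 R n),
        open_definable (projT2 (projT2 t)) &
        forall phi : open_formula (projT1 t) (n ^ 2),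
          defines phi (projT2 (projT2 t)) -> ((n - 1) ^ n <= num_literals phi)%N].
  case: (leqP 3 n) => [/(ex_hard_relation R)[tau [A [T HT]]]|_].
    by exists (existT _ tau (existT _ A T)).
  (* Below 3 nothing is claimed, and a one-point structure with empty vocabulary is a default
     value. *)
  have U0 : (0 < #|{: unit}|)%N by rewrite card_unit.
  pose V := @Vocabulary void (fun _ => 0%N).
  by exists (existT _ V (existT _ (@Structure V unit (fun r => finset.set0) U0) finset.set0)).
pose t n := projT1 (cid (H n)); have tP n := projT2 (cid (H n)).
exists (fun n => projT1 (t n)), (fun n => projT1 (projT2 (t n))),
  (fun n => projT2 (projT2 (t n))); split=> [|n /tP[]//].
apply/eqOP; exists 198; split=> // c c198; near=> n.
have /tP[sz _ _] : (3 <= n)%N by near: n; exact: nbhs_infty_ge.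
have f0 : 0 <= size_rel R (projT2 (projT2 (t n))).
  have p0 (x : nat) : 0 <= log1 R x by apply: le_trans (log1_ge1 R x).
  by rewrite /size_rel /size_struct /size_voc !(mulr_ge0, addr_ge0).
rewrite ger0_norm //; apply: le_trans sz _.
have g0 : 0 <= n%:R ^+ 3 * log1 R n by rewrite mulr_ge0 // (le_trans _ (log1_ge1 R n)).
by rewrite ger0_norm // ler_wpM2r // ltW.
Unshelve. all: by end_near.
Qed.
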